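(* Let $(\mathbf{x}_i^T,y_i)$, $i=1,\dots,n$, be a sample with $\mathbf{x}_i\in\mathbb{R}^p$, $y_i\in\mathbb{R}$. Let $\rho_0,\rho_1$ be bounded $\rho$-functions with $\rho_1\le\rho_0$, let $0<b<1$, $t>0$, $\varsigma>0$, and let $\hat{\boldsymbol\beta}_1,\hat{\boldsymbol\beta}_2$ be consistent initial estimates of the regression parameter $\boldsymbol\beta_0$. Let $\hat{\boldsymbol\beta}_A$ be the adaptive MM-Bridge estimator $$\hat{\boldsymbol\beta}_A=\arg\min_{\boldsymbol\beta\in\mathbb{R}^p}\ \sum_{i=1}^n\rho_1\!\left(\frac{y_i-\mathbf{x}_i^T\boldsymbol\beta}{s_n(\mathbf{r}(\hat{\boldsymbol\beta}_1))}\right)+\iota_n\sum_{j=1}^p\frac{|\beta_j|^t}{|\hat\beta_{2,j}|^{\varsigma}} ,$$ where, if the model contains an intercept, the intercept is not penalized. If $\iota_n>0$ is fixed, then the finite-sample replacement breakdown points satisfy $FBP(\hat{\boldsymbol\beta}_A)\ge FBP(\hat{\boldsymbol\beta}_2)$.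
   Context: Model: the $(\mathbf{x}_i^T,y_i)$ are i.i.d. with $y_i=\mathbf{x}_i^T\boldsymbol\beta_0+u_i$, $\boldsymbol\beta_0\in\mathbb{R}^p$, and $u_i$ independent of $\mathbf{x}_i$; consistency of $\hat{\boldsymbol\beta}_1,\hat{\boldsymbol\beta}_2$ refers to this model. ''Fixed'' means that $\iota_n$ is not selected by a data-driven procedure. A bounded $\rho$-function is a function $\rho:\mathbb{R}\to[0,1]$ such that $\rho(u)$ is a nondecreasing function of $|u|$, $\rho(0)=0$, $\lim_{u\to\infty}\rho(u)=1$, and $\rho$ is strictly increasing on $\{u>0:\rho(u)<1\}$. Residuals: $\mathbf{r}(\boldsymbol\beta)=(r_1(\boldsymbol\beta),\dots,r_n(\boldsymbol\beta))$ with $r_i(\boldsymbol\beta)=y_i-\mathbf{x}_i^T\boldsymbol\beta$. M-estimate of scale: for $\mathbf{u}=(u_1,\dots,u_n)$, $s_n(\mathbf{u})=\inf\{s>0:\frac1n\sum_{i=1}^n\rho_0(u_i/s)\le b\}$. If $\hat\beta_{2,j}=0$ for some penalized coordinate $j$, then $\hat\beta_{A,j}=0$ (the $j$-th penalty term is read as $0$ when $\beta_j=0$ and $+\infty$ otherwise). Finite-sample replacement breakdown point: for a regression estimator $\hat{\boldsymbol\beta}$ and a data set $\mathbf{Z}=\{(\mathbf{x}_1^T,y_1),\dots,(\mathbf{x}_n^T,y_n)\}$, let $\mathcal{Z}_m$ be the set of all data sets (of size $n$) with at least $n-m$ elements in common with $\mathbf{Z}$. Then $FBP(\hat{\boldsymbol\beta})=m^*/n$,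 where $m^*=\max\{m\ge0:\hat{\boldsymbol\beta}(\mathbf{Z}_m)\text{ is bounded for all }\mathbf{Z}_m\in\mathcal{Z}_m\}$, i.e. the largest $m$ such that $\{\hat{\boldsymbol\beta}(\mathbf{Z}_m):\mathbf{Z}_m\in\mathcal{Z}_m\}$ is bounded. When $\hat{\boldsymbol\beta}_A$ is evaluated at a contaminated data set, $\hat{\boldsymbol\beta}_1$, $\hat{\boldsymbol\beta}_2$ and the scale are computed from that same data set.
   Formalization: If the model contains an intercept, the breakdown points compared are those of the penalized coefficient vectors only, excluding the intercept, since the inequality can fail for the unpenalized intercept component; without an intercept the statement is unchanged. *)

(* Defs.v *)
From mathcomp Require Import all_boot all_order all_algebra perm.
From mathcomp Require Import all_classical all_reals all_analysis.
Import Order.TTheory GRing.Theory Num.Theory.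
Import numFieldNormedType.Exports.

Set Implicit Arguments.
Unset Strict Implicit.
Unset Printing Implicit Defensive.

Local Open Scope classical_set_scope.
Local Open Scope ring_scope.

Definition bounded_rho (R : realType) (rho : R -> R) : Prop :=
  [/\ forall u, 0 <= rho u <= 1,
      forall u v, `|u| <= `|v| -> rho u <= rho v,
      rho 0 = 0,
      rho u @[u --> +oo] --> (1 : R) &
      {in [pred u | (0 < u) && (rho u < 1)] &, {homo rho : u v / u < v}}].

(* rho(+oo) = rho(-oo) = 1 *)
Definition rho_ext (R : realType) (rho : R -> R) (x : \bar R) : R :=
  if x is r%:E then rho r else 1.

(* Z i is the pair (x_i, y_i); the regressor x_i does not contain a constant
   entry for the intercept. *)
Definition dataset (R : realType) (p n : nat) : Type :=
  {ffun 'I_n -> 'rV[R]_p * R}.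

(* A parameter is a pair (intercept, beta): the sum of penalties runs over all
   p coordinates of beta, so an unpenalized intercept is kept apart from beta.
   In a model without intercept (ic = false) the first component is 0 and the
   parameter is just beta. *)
Definition param (R : realType) (p : nat) : Type := (R * 'rV[R]_p)%type.

Definition param_space (R : realType) (p : nat) (ic : bool) :
    set (param R p) :=
  [set th | ~~ ic -> th.1 = 0].
Arguments param_space R p ic : clear implicits.

Definition predictor (R : realType) (p : nat) (th : param R p)
    (x : 'rV[R]_p) : R :=
  th.1 + (x *m th.2^T) 0 0.

Definition residual (R : realType) (p n : nat) (Z : dataset R p n)
    (th : param R p) (i : 'I_n) : R :=
  (Z i).2 - predictor th (Z i).1.

(* The infimum is taken in \bar R, where the infimum of the empty set is
   +oo. *)
Definition mscale (R : realType) (rho0 : R -> R) (b : R) (n : nat)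
    (u : 'I_n -> R) : \bar R :=
  ereal_inf [set s%:E | s in
    [set s : R | 0 < s /\ n%:R^-1 * (\sum_(i < n) rho0 (u i / s)) <= b]].

(* Divisions are in \bar R, where a / 0 is +oo for a > 0 and -oo for a < 0,
   0 / 0 = 0 and a / +oo = 0.  A zero scale thus gives loss 1 to a nonzero
   residual and loss 0 to a zero one, and the j-th penalty term with
   th2.2 0 j = 0 is 0 if th.2 0 j = 0 and +oo otherwise. *)
Definition bridge_objective (R : realType) (p n : nat) (rho0 rho1 : R -> R)
    (b t vs iota : R) (Z : dataset R p n) (th1 th2 th : param R p) : \bar R :=
  (\sum_(i < n)
      (rho_ext rho1 ((residual Z th i)%:E / mscale rho0 b (residual Z th1)))%:E
   + iota%:E * \sum_(j < p)
      ((`|th.2 0 j| `^ t)%:E / (`|th2.2 0 j| `^ vs)%:E))%E.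

(* A minimizer need not be unique, so an estimator is any selection of one. *)
Definition adaptive_mm_bridge (R : realType) (p n : nat) (ic : bool)
    (rho0 rho1 : R -> R) (b t vs iota : R)
    (est1 est2 estA : dataset R p n -> param R p) : Prop :=
  forall Z, param_space R p ic (estA Z) /\
    forall th, param_space R p ic th ->
      (bridge_objective rho0 rho1 b t vs iota Z (est1 Z) (est2 Z) (estA Z)
       <= bridge_objective rho0 rho1 b t vs iota Z (est1 Z) (est2 Z) th)%E.

(* Data sets are unordered: common elements are counted with multiplicity, up
   to a reordering s of the observations. *)
Definition contaminated (R : realType) (p n : nat) (Z : dataset R p n)
    (m : nat) : set (dataset R p n) :=
  [set Z' | exists s : 'S_n, (n - m <= #|[pred i | Z' (s i) == Z i]|)%N].

(* m is capped at n, as contaminated Z m is the set of all data sets for every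
   m >= n; m = 0 is always admissible since contaminated Z 0 is finite. *)
Definition FBP (R : realType) (p n : nat) (est : dataset R p n -> 'rV[R]_p)
    (Z : dataset R p n) : R :=
  (\max_(m < n.+1 |
      `[< bounded_set [set est Z' | Z' in contaminated Z m] >]) m)%:R / n%:R.

Definition borel (T : topologicalType) : set (set T) := <<s @open T >>.
Arguments borel T : clear implicits.

Definition random_element (d : measure_display) (Om : measurableType d)
    (T : topologicalType) (X : Om -> T) : Prop :=
  forall A, borel T A -> measurable (X @^-1` A).

Definition iid (d : measure_display) (Om : measurableType d) (R : realType)
    (P : probability Om R) (T : topologicalType) (X : nat -> Om -> T) : Prop :=
  [/\ forall i, random_element (X i),
      forall i A, borel T A -> P (X i @^-1` A) = P (X 0%N @^-1` A) &
      forall (J : seq nat) (A : nat -> set T), uniq J ->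
        (forall i, i \in J -> borel T (A i)) ->
        P (\bigcap_(i in [set` J]) (X i @^-1` A i))
        = \big[*%E/1%E]_(i <- J) P (X i @^-1` A i)].

Definition independent (d : measure_display) (Om : measurableType d)
    (R : realType) (P : probability Om R) (T U : topologicalType)
    (X : Om -> T) (Y : Om -> U) : Prop :=
  forall A B, borel T A -> borel U B ->
    P (X @^-1` A `&` Y @^-1` B) = (P (X @^-1` A) * P (Y @^-1` B))%E.

Definition linear_model (d : measure_display) (Om : measurableType d)
    (R : realType) (P : probability Om R) (p : nat)
    (x : nat -> Om -> 'rV[R]_p) (y u : nat -> Om -> R) (th0 : param R p) :
    Prop :=
  [/\ iid P (fun i w => (x i w, y i w)),
      forall i w, y i w = predictor th0 (x i w) + u i w &
      forall i, independent P (x i) (u i)].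

Definition sample (Om : Type) (R : realType) (p : nat)
    (x : nat -> Om -> 'rV[R]_p) (y : nat -> Om -> R) (n : nat) (w : Om) :
    dataset R p n :=
  [ffun i : 'I_n => (x i w, y i w)].

(* Convergence in probability of the n-th estimator, applied to the first n
   observations. *)
Definition consistent (d : measure_display) (Om : measurableType d)
    (R : realType) (P : probability Om R) (p : nat)
    (x : nat -> Om -> 'rV[R]_p) (y : nat -> Om -> R)
    (est : forall n, dataset R p n -> param R p) (th0 : param R p) : Prop :=
  (forall n, random_element (fun w => est n (sample x y n w))) /\
  forall eps : R, 0 < eps ->
    P [set w | eps < `|est n (sample x y n w) - th0|] @[n --> \oo] --> 0%E.

(* Main.v *)
Require Import Defs.
From mathcomp Require Import all_boot all_order all_algebra.
From mathcomp Require Import all_classical all_reals all_analysis.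
Import Order.TTheory GRing.Theory Num.Theory.
Import numFieldNormedType.Exports.
Local Open Scope ring_scope.

(** The null parameter has loss at most [n] and zero penalty, so it bounds the
    optimal objective by [n] on every data set.  Hence each penalty term of the
    minimizer is at most [n / iota], that is,
    [`|beta_j| `^ t <= n / iota * `|beta2_j| `^ vs]: wherever the second initial
    estimate is bounded, so is the adaptive estimate. *)

Lemma le_of_powR_ratio (R : realType) (a c t vs K M : R) :
  0 < t -> 0 <= vs -> 0 <= a -> 0 <= c -> c <= M -> 0 <= K ->
  ((a `^ t)%:E / (c `^ vs)%:E <= K%:E)%E -> a <= (K * M `^ vs) `^ t^-1.
Proof.
move=> t0 vs0 a0 c0 cM K0.
have M0 : 0 <= M := le_trans c0 cM.
rewrite inver; case: ifPn => [_|cvs_neq0].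
  have [/powR_eq0_eq0 -> _|/negPf at_neq0] := eqVneq (a `^ t) 0.
    exact: powR_ge0.
  by rewrite gt0_muley ?leye_eq // lte_fin lt0r at_neq0 powR_ge0.
rewrite -EFinM lee_fin ler_pdivrMr ?lt0r ?cvs_neq0 ?powR_ge0// => ratio_le.
rewrite -[leLHS](powRr1 a0) -(divff (lt0r_neq0 t0)) powRrM.
rewrite ge0_ler_powR ?nnegrE ?powR_ge0 ?invr_ge0 ?(ltW t0)//.
  by rewrite mulr_ge0 ?powR_ge0.
rewrite (le_trans ratio_le)// ler_wpM2l//.
by rewrite ge0_ler_powR ?nnegrE.
Qed.

(** The norm is the maximum of the absolute entries, started at 0; [0 <= B] handles that start,
    which is the whole maximum when [p = 0]. *)
Lemma rv_norm_le (R : realType) (p : nat) (v : 'rV[R]_p) (B : R) :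
  0 <= B -> (forall j, `|v 0 j| <= B) -> `|v| <= B.
Proof.
move=> B0 vB; rewrite [leLHS]mx_normrE; apply: bigmax_le => // -[i j] _ /=.
by rewrite ord1.
Qed.

Lemma rv_entry_le_norm (R : realType) (p : nat) (v : 'rV[R]_p) j :
  `|v 0 j| <= `|v|.
Proof.
rewrite [leRHS]mx_normrE.
exact: (le_bigmax _ (fun ij : 'I_1 * 'I_p => `|v ij.1 ij.2|) (0, j)).
Qed.

Lemma rho_ext_ge0 (R : realType) (rho : R -> R) (u : \bar R) :
  bounded_rho rho -> 0 <= rho_ext rho u.
Proof. by case=> rho01 _ _ _ _; case: u => //= r; have /andP[] := rho01 r. Qed.

Lemma rho_ext_le1 (R : realType) (rho : R -> R) (u : \bar R) :
  bounded_rho rho -> rho_ext rho u <= 1.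
Proof. by case=> rho01 _ _ _ _; case: u => //= r; have /andP[] := rho01 r. Qed.

Section Objective.
Context {R : realType} {p n : nat} {ic : bool} {rho0 rho1 : R -> R}.
Context {b t vs iota : R}.
Hypotheses (hrho1 : bounded_rho rho1) (t0 : 0 < t) (iota0 : 0 < iota).
Implicit Types (Z : dataset R p n) (th : param R p).

Lemma bridge_objective0_le Z th1 th2 :
  (bridge_objective rho0 rho1 b t vs iota Z th1 th2 (0, 0)%R <= n%:R%:E)%E.
Proof.
rewrite /bridge_objective [X in (iota%:E * X)%E]big1 ?mule0 ?adde0; last first.
  (* Since [t] is nonzero the numerator is 0, and [0 * +oo = 0] covers the coordinates where [th2]
     vanishes. *)
  by move=> j _ /=; rewrite mxE normr0 powR0 ?(lt0r_neq0 t0) // mul0e.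
rewrite sumEFin lee_fin -[n in leRHS]card_ord -sumr_const ler_sum // => i _.
exact: rho_ext_le1.
Qed.

(** Losses and penalty terms are all nonnegative, so dropping every summand but the [j]-th penalty
    only decreases the objective. The comparison stays in [\bar R], as that term could a priori be
    infinite. *)
Lemma penalty_le Z th1 th2 th j :
  (bridge_objective rho0 rho1 b t vs iota Z th1 th2 th <= n%:R%:E)%E ->
  ((`|th.2 0 j| `^ t)%:E / (`|th2.2 0 j| `^ vs)%:E <= (n%:R / iota)%:E)%E.
Proof.
have term_ge0 k : (0 <= (`|th.2 0 k| `^ t)%:E / (`|th2.2 0 k| `^ vs)%:E)%E.
  by rewrite mule_ge0 // ?inve_ge0 lee_fin powR_ge0.
move=> obj_le.
rewrite EFinM lee_pdivlMr // muleC; apply: le_trans obj_le.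
rewrite /bridge_objective; apply: (@le_trans _ _
  (iota%:E * \sum_(k < p) ((`|th.2 0 k| `^ t)%:E / (`|th2.2 0 k| `^ vs)%:E))%E).
  rewrite lee_wpmul2l ?lee_fin ?(ltW iota0) //.
  by rewrite (bigD1 j) //= leeDl // sume_ge0.
rewrite leeDr // sume_ge0 // => i _; rewrite lee_fin.
exact: rho_ext_ge0.
Qed.

(** The bound depends on [Z] only through [M], so it is uniform over any family of data sets on
    which [est2] is bounded by [M]. *)
Lemma adaptive_mm_bridge_norm_le (est1 est2 estA : dataset R p n -> param R p)
    Z (M : R) :
  0 <= vs -> adaptive_mm_bridge ic rho0 rho1 b t vs iota est1 est2 estA ->
  `|(est2 Z).2| <= M -> `|(estA Z).2| <= (n%:R / iota * M `^ vs) `^ t^-1.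
Proof.
move=> vs0 hestA est2M; apply: rv_norm_le => [|j]; first exact: powR_ge0.
(* The null parameter has zero intercept, hence is admissible with or without an intercept in the
   model. *)
have [_ /(_ (0, 0) (fun=> erefl)) minA] := hestA Z.
apply: (@le_of_powR_ratio _ _ `|(est2 Z).2 0 j| _ vs) => //.
- exact: le_trans (rv_entry_le_norm _ _ _ _) est2M.
- by rewrite divr_ge0 // ltW.
- exact: penalty_le (le_trans minA (bridge_objective0_le _ _ _)).
Qed.

End Objective.

Lemma bounded_imageP (R : realType) (p : nat) (T : Type) (A : set T)
    (f : T -> 'rV[R]_p) :
  bounded_set [set f z | z in A]%classic <->
  exists M : R, forall z, A z -> `|f z| <= M.
Proof.
split=> [[M [_ hM]]|[M hM]].
  (* [bounded_set] gives the bound only for reals strictly above [M]. *)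
  exists (M + 1) => z Az; apply: (hM (M + 1)); first by rewrite ltrDl.
  by exists z.
exists M; split=> [|M' MM' _ [z Az <-]]; first exact: num_real.
exact: le_trans (hM z Az) (ltW MM').
Qed.

(** With [A] the set [contaminated Z m], each [m] admissible for [est] is admissible for [est'], so
    the second maximum runs over a larger set. *)
Lemma FBP_le (R : realType) (p n : nat) (est est' : dataset R p n -> 'rV[R]_p)
    (Z : dataset R p n) :
  (forall A : set (dataset R p n),
     bounded_set [set est z | z in A]%classic ->
     bounded_set [set est' z | z in A]%classic) ->
  FBP est Z <= FBP est' Z.
Proof.
move=> bd; rewrite ler_wpM2r ?invr_ge0 // ler_nat.
apply/bigmax_leqP => m /asboolP/bd/asboolP bdm.
exact: (leq_bigmax_cond (F := fun i : 'I_n.+1 => nat_of_ord i)).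
Qed.

Theorem theorem2 (R : realType) (d : measure_display) (Om : measurableType d)
    (P : probability Om R) (p : nat) (ic : bool)
    (x : nat -> Om -> 'rV[R]_p) (y u : nat -> Om -> R) (th0 : param R p)
    (hth0 : param_space R p ic th0)
    (hmodel : linear_model P x y u th0)
    (est1 est2 : forall n : nat, dataset R p n -> param R p)
    (hest1 : forall (n : nat) (Z : dataset R p n),
       param_space R p ic (est1 n Z))
    (hest2 : forall (n : nat) (Z : dataset R p n),
       param_space R p ic (est2 n Z))
    (hcons1 : consistent P x y est1 th0)
    (hcons2 : consistent P x y est2 th0)
    (rho0 rho1 : R -> R)
    (hrho0 : bounded_rho rho0) (hrho1 : bounded_rho rho1)
    (hrho10 : forall v : R, rho1 v <= rho0 v)
    (b t vs : R) (hb : 0 < b < 1) (ht : 0 < t) (hvs : 0 < vs)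
    (n : nat) (hn : (0 < n)%N)
    (iota : R) (hiota : 0 < iota)
    (estA : dataset R p n -> param R p)
    (hestA : adaptive_mm_bridge ic rho0 rho1 b t vs iota
               (est1 n) (est2 n) estA)
    (Z : dataset R p n) :
  FBP (fun Z' : dataset R p n => (est2 n Z').2) Z
    <= FBP (fun Z' : dataset R p n => (estA Z').2) Z.
Proof.
apply: FBP_le => A /bounded_imageP[M hM]; apply/bounded_imageP.
(* One constant serves all of [A] because [iota] is fixed: it does not vary with the data set
   [z]. *)
exists ((n%:R / iota * M `^ vs) `^ t^-1) => z /hM.
exact: (adaptive_mm_bridge_norm_le hrho1 ht hiota _ _ _ z M (ltW hvs) hestA).
Qed.
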